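(* Let $a_2$ and $a_3$ be integers and let $\{u_n\}_{n\ge 0}$ be the third-order recurrence sequence defined by $$u_0=0,\quad u_1=-a_2,\quad u_2=-a_3,\qquad u_{n+3}+a_2u_{n+1}+a_3u_n=0\quad (n\ge 0).$$ Let $f=x^3+a_2x+a_3$, let $d=9a_3^2-4a_2^3$, and let $D=\mathrm{disc}(f)$. Let $p$ be a prime such that $$p\nmid 6Da_2a_3\bigl((20a_2^3a_3+27a_2^3+9a_2d)^2-d(31a_2^2+d)^2\bigr).$$ Then $$N_p(f)=\begin{cases}3 & \text{if } Du_{p-1}^2\equiv 0 \pmod p;\\ 0 & \text{if } Du_{p-1}^2\equiv a_2^4 \pmod p;\\ 1 & \text{otherwise.}\end{cases}$$
   Context: For a polynomial $f\in\mathbb{Z}[x]$ and a prime $p$, $N_p(f)$ denotes the number of integers $0\le a<p$ with $f(a)\equiv 0\pmod p$ (the number of distinct roots of $f$ modulo $p$). $\mathrm{disc}(f)$ is the discriminant of $f$. *)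

(* Defs.v *)
From mathcomp Require Import all_boot all_order all_algebra.
From mathcomp Require Import ring.

Set Implicit Arguments.
Unset Strict Implicit.
Unset Printing Implicit Defensive.

Import GRing.Theory.
Local Open Scope ring_scope.

(* Disc(f) = (-1)^(n(n-1)/2) Res(f, f') / lc(f), with n = deg f >= 1; the     *)
(* division is exact over the integers. [Sylvester_mx] lists coefficients by   *)
(* increasing degree, so [resultant f g] is (-1)^(deg f * deg g) times the     *)
(* usual Res(f, g); here n(n-1) is even and the two conventions agree.         *)
Definition disc (f : {poly int}) : int :=
  let n := (size f).-1 in
  ((-1) ^+ 'C(n, 2) * resultant f f^`() %/ lead_coef f)%Z.

Definition Np (p : nat) (f : {poly int}) : nat :=
  #|[set a : 'I_p | (p %| f.[(a : nat)%:Z])%Z]|.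

Lemma size_depressed_cubic (a b : int) :
  size ('X^3 + a *: 'X + b%:P : {poly int}) = 4%N.
Proof.
rewrite -addrA size_polyDl ?size_polyXn //.
rewrite (leq_ltn_trans (size_polyD _ _)) // gtn_max.
rewrite (leq_ltn_trans (size_scale_leq _ _)) ?size_polyX //=.
by rewrite (leq_ltn_trans (size_polyC_leq1 _)).
Qed.

Fixpoint laplace (n : nat) (F : nat -> nat -> int) : int :=
  if n is m.+1 then
    foldr (fun j x => F 0%N j *
      ((-1) ^+ j * laplace m (fun i k => F i.+1 (bump j k))) + x) 0 (iota 0 n)
  else 1.

Lemma det_laplace n (F : nat -> nat -> int) (M : 'M[int]_n) :
  (forall i j, M i j = F i j) -> \det M = laplace n F.
Proof.
elim: n F M => [|n IH] F M ME; first by rewrite det_mx00.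
rewrite (expand_det_row _ ord0).
transitivity (\sum_(0 <= j < n.+1) F 0%N j *
    ((-1) ^+ j * laplace n (fun i k => F i.+1 (bump j k)))); last by rewrite unlock.
rewrite big_mkord; apply: eq_bigr => j _; rewrite ME /cofactor add0n.
by congr (_ * (_ * _)); apply: IH => i k; rewrite !mxE ME.
Qed.

Lemma disc_depressed_cubic (a b : int) :
  disc ('X^3 + a *: 'X + b%:P) = - 4 * a ^+ 3 - 27 * b ^+ 2.
Proof.
set f := _ + _; have sf : size f = 4%N := size_depressed_cubic a b.
pose c k : int := if k is 0 then b else if k is 1 then a else
                  if k is 3 then 1 else 0.
have fE k : f`_k = c k.
  rewrite /f !coefD coefXn coefZ coefX coefC.
  by case: k => [|[|[|[|k]]]] //=; rewrite ?mulr0 ?mulr1 ?addr0 ?add0r.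
have dfE k : f^`()`_k = c k.+1 *+ k.+1 by rewrite coef_deriv fE.
have sdf : size f^`() = 3%N.
  apply/eqP; rewrite eqn_leq; apply/andP; split.
    by rewrite -ltnS -sf lt_size_deriv // -size_poly_eq0 sf.
  by rewrite ltnNge; apply/negP => /leq_sizeP/(_ 2%N (leqnn _)); rewrite dfE.
rewrite /disc lead_coefE fE sf /= divz1 /resultant.
suff: forall M : 'M[int]_((size f^`()).-1 + (size f).-1),
  M = Sylvester_mx f f^`() -> \det M = 4 * a ^+ 3 + 27 * b ^+ 2.
  by move=> /(_ _ erefl) ->; rewrite bin2 /=; ring.
move=> M defM.
have {defM} ME i j : M i j =
    if (i < 2)%N then c (j - i)%N *+ (i <= j)%N
    else (c (j - (i - 2)).+1 *+ (j - (i - 2)).+1) *+ (i - 2 <= j)%N.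
  rewrite defM Sylvester_mxE; case: splitP => k ->.
    by rewrite fE ifT //; apply: leq_trans (ltn_ord k) _; rewrite sdf.
  have -> : ((size f^`()).-1 + k = 2 + k)%N by rewrite sdf.
  by rewrite dfE ltnNge leq_addr /= addKn.
move: M ME; rewrite sdf sf /= => M ME.
pose F i j := nth 0 (nth [::] [:: [:: b; a; 0; 1; 0];
                                  [:: 0; b; a; 0; 1];
                                  [:: a; 0; 3; 0; 0];
                                  [:: 0; a; 0; 3; 0];
                                  [:: 0; 0; a; 0; 3]] i) j : int.
rewrite (@det_laplace _ F) => [|i j]; first by rewrite /= /F /=; ring.
rewrite ME.
by move: i j => [[|[|[|[|[|?]]]]] ?] [[|[|[|[|[|?]]]]] ?].
Qed.

(* Main.v *)
Require Import Defs.
From mathcomp Require Import all_boot all_order all_algebra.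
From mathcomp Require Import all_field ring.

Set Implicit Arguments.
Unset Strict Implicit.
Unset Printing Implicit Defensive.

Import GRing.Theory.
Local Open Scope ring_scope.

(** Over a splitting field of characteristic p let x, y, z be the roots of f and
    Delta = (x-y)(y-z)(z-x), so that D = Delta^2.  Partial fractions give
    Delta u_n = -(x^(n+3)(y-z) + y^(n+3)(z-x) + z^(n+3)(x-y)).  For n = p-1 the
    power x^(p+2) is x^2 F(x), with F the Frobenius map, which permutes the roots
    and whose fixed points are the roots counted by Np.  If F fixes all roots,
    Delta u_(p-1) = Delta u_0 = 0; if it is a 3-cycle, Delta u_(p-1) is
    +-(xy+yz+zx)^2 = +-a2^2; if it fixes only x, Delta u_(p-1) is
    +-a2 x (y-z), and D u_(p-1)^2 - a2^4 is, up to sign,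
    a2^2 yz (x-y)(x-z), which does not vanish. *)

Lemma cubic_recurrence_closed_form (R : comNzRingType) (x y z : R)
    (v : nat -> R) :
    x + y + z = 0 ->
    v 0%N = 0 -> v 1%N = - (x * y + y * z + z * x) -> v 2%N = x * y * z ->
    (forall n, v n.+3 = - (x * y + y * z + z * x) * v n.+1 + x * y * z * v n) ->
  forall n, (x - y) * (y - z) * (z - x) * v n =
    - (x ^+ n.+3 * (y - z) + y ^+ n.+3 * (z - x) + z ^+ n.+3 * (x - y)).
Proof.
move=> sum0 v0 v1 v2 vS; have zE : z = - x - y.
  by move/eqP: sum0; rewrite addrC addr_eq0 opprD => /eqP.
rewrite {}zE {sum0} in v1 v2 vS *.
(* Three consecutive indices are carried together because the recurrence has order three. With z
   eliminated, every check is a polynomial identity in x and y. *)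
suff H n : [/\ (x - y) * (y - (- x - y)) * (- x - y - x) * v n =
      - (x ^+ n.+3 * (y - (- x - y)) + y ^+ n.+3 * (- x - y - x)
         + (- x - y) ^+ n.+3 * (x - y)),
    (x - y) * (y - (- x - y)) * (- x - y - x) * v n.+1 =
      - (x ^+ n.+4 * (y - (- x - y)) + y ^+ n.+4 * (- x - y - x)
         + (- x - y) ^+ n.+4 * (x - y))
  & (x - y) * (y - (- x - y)) * (- x - y - x) * v n.+2 =
      - (x ^+ n.+4.+1 * (y - (- x - y)) + y ^+ n.+4.+1 * (- x - y - x)
         + (- x - y) ^+ n.+4.+1 * (x - y))].
  by move=> n; case: (H n).
elim: n => [|n [IH0 IH1 IH2]]; first by rewrite v0 v1 v2; split; ring.
split=> //; rewrite vS mulrDr mulrCA IH1 mulrCA IH0 !exprS; ring.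
Qed.

(** [F] restricts to one of the six permutations of the roots, and [w] is evaluated for each of
    them. Squaring removes the sign that distinguishes the two 3-cycles. *)
Lemma root_permutation_trichotomy (K : fieldType) (x y z : K) (F : K -> K) :
    uniq [:: x; y; z] -> x + y + z = 0 -> x * y * z != 0 ->
    x * y + y * z + z * x != 0 -> injective F ->
    {in [:: x; y; z], forall t, F t \in [:: x; y; z]} ->
  let w := x ^+ 2 * F x * (y - z) + y ^+ 2 * F y * (z - x)
           + z ^+ 2 * F z * (x - y) in
  let c := count (fun t => F t == t) [:: x; y; z] in
  [\/ c = 3%N /\ w ^+ 2 = 0,
      c = 0%N /\ w ^+ 2 = (x * y + y * z + z * x) ^+ 4
    | [/\ c = 1%N, w ^+ 2 != 0 & w ^+ 2 != (x * y + y * z + z * x) ^+ 4]].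
Proof.
rewrite /= !inE negb_or andbT => /andP[/andP[nxy nxz] nyz] sum0 xyz0 a0 injF.
move=> stabF.
have zE : z = - x - y.
  by move/eqP: sum0; rewrite addrC addr_eq0 opprD => /eqP.
(* The three transpositions differ by a cyclic relabelling of the roots, so one computation serves
   them all: [r] is the fixed root, [s] and [t] are exchanged. *)
have one_fixed (r s t : K) : r + s + t = 0 -> r != s -> r != t -> s != t ->
    r * s * t != 0 -> r * s + s * t + t * r != 0 ->
    (r * (r ^+ 2 - s * t) * (s - t)) ^+ 2 != 0 /\
    (r * (r ^+ 2 - s * t) * (s - t)) ^+ 2 != (r * s + s * t + t * r) ^+ 4.
  move=> sum0' nrs nrt nst rst0 b0.
  have tE : t = - r - s.
    by move/eqP: sum0'; rewrite addrC addr_eq0 opprD => /eqP.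
  have /andP[/andP[r0 s0] t0] : (r != 0) && (s != 0) && (t != 0).
    by rewrite -!negb_or -!mulf_eq0.
  have E1 : r ^+ 2 - s * t = - (r * s + s * t + t * r) by rewrite tE; ring.
  have E2 : (r * (r ^+ 2 - s * t) * (s - t)) ^+ 2 - (r * s + s * t + t * r) ^+ 4
      = - ((r * s + s * t + t * r) ^+ 2 * (s * t) * ((r - s) * (r - t))).
    by rewrite tE; ring.
  have w0 : r * (r ^+ 2 - s * t) * (s - t) != 0.
    by rewrite E1 !mulf_neq0 ?oppr_eq0 ?subr_eq0.
  split; first exact: expf_neq0.
  by rewrite -subr_eq0 E2 oppr_eq0 !mulf_neq0 ?subr_eq0 ?expf_neq0.
have Fxy : F x != F y by rewrite (inj_eq injF).
have Fxz : F x != F z by rewrite (inj_eq injF).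
have Fyz : F y != F z by rewrite (inj_eq injF).
have nyx : y != x by rewrite eq_sym.
have nzx : z != x by rewrite eq_sym.
have nzy : z != y by rewrite eq_sym.
have := stabF z; have := stabF y; have := stabF x.
rewrite !inE !eqxx !orbT => /(_ isT) Hx /(_ isT) Hy /(_ isT) Hz.
move: Fxy Fxz Fyz.
(* Of the 27 possible assignments, injectivity leaves six, in this order: the identity, the
   transpositions fixing x and z, the two 3-cycles, the transposition fixing y. *)
case/or3P: Hx => /eqP->; case/or3P: Hy => /eqP->; case/or3P: Hz => /eqP->;
  rewrite ?eqxx ?(negbTE nxy) ?(negbTE nxz) ?(negbTE nyz)
    ?(negbTE nyx) ?(negbTE nzx) ?(negbTE nzy) //= => _ _ _.
- by apply: Or31; split=> //; rewrite zE; ring.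
- apply: Or33; case: (one_fixed x y z) => // n0 n4.
  have -> : x ^+ 2 * x * (y - z) + y ^+ 2 * z * (z - x) + z ^+ 2 * y * (x - y)
      = x * (x ^+ 2 - y * z) * (y - z) by ring.
  by split.
- apply: Or33; case: (one_fixed z x y) => //; try by rewrite -?sum0; ring.
  + by rewrite (_ : z * x * y = x * y * z) //; ring.
  + by rewrite (_ : z * x + x * y + y * z = x * y + y * z + z * x) //; ring.
  move=> n0 n4.
  have -> : x ^+ 2 * y * (y - z) + y ^+ 2 * x * (z - x) + z ^+ 2 * z * (x - y)
      = z * (z ^+ 2 - x * y) * (x - y) by ring.
  have <- : z * x + x * y + y * z = x * y + y * z + z * x by ring.
  by split.
- by apply: Or32; split=> //; rewrite zE; ring.
- by apply: Or32; split=> //; rewrite zE; ring.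
- apply: Or33; case: (one_fixed y z x) => //; try by rewrite -?sum0; ring.
  + by rewrite (_ : y * z * x = x * y * z) //; ring.
  + by rewrite (_ : y * z + z * x + x * y = x * y + y * z + z * x) //; ring.
  move=> n0 n4.
  have -> : x ^+ 2 * z * (y - z) + y ^+ 2 * y * (z - x) + z ^+ 2 * x * (x - y)
      = y * (y ^+ 2 - z * x) * (z - x) by ring.
  have <- : y * z + z * x + x * y = x * y + y * z + z * x by ring.
  by split.
Qed.

Lemma natr_ord_inj (R : nzRingType) (p : nat) :
  p \in [pchar R] -> injective (fun i : 'I_p => (i : nat)%:R : R).
Proof.
move=> pR i j /eqP; wlog le_ij : i j / (i <= j)%N => [W|] eq_ij.
  by case/orP: (leq_total i j) => /W -> //; rewrite eq_sym.
apply/val_inj/eqP; rewrite eqn_leq le_ij /= -subn_eq0 -leqn0 leqNgt.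
apply/negP => lt0; have := @dvdn_leq p _ lt0; rewrite (dvdn_pcharf pR) natrB //.
rewrite subr_eq0 eq_sym eq_ij leqNgt => /(_ isT).
by rewrite (leq_ltn_trans (leq_subr _ _) (ltn_ord j)).
Qed.

(** The prime field already supplies p roots of X^p - X, a polynomial of degree p; a fixed [t]
    outside it would be one root too many. *)
Lemma Frobenius_fixed_natr (K : fieldType) (p : nat) (t : K) :
  p \in [pchar K] -> (t ^+ p == t) = (t \in [seq (i : nat)%:R | i : 'I_p]).
Proof.
move=> pK; have pp := pcharf_prime pK.
have natFix (n : nat) : (n%:R : K) ^+ p = n%:R.
  by rewrite -(pFrobenius_autE pK) rmorph_nat.
apply/eqP/mapP => [tp|[i _ ->]]; last exact: natFix.
pose s := [seq ((i : nat)%:R : K) | i : 'I_p].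
case: (boolP (t \in s)) => [/mapP[i] | nts]; first by exists i.
have sz : size ('X^p - 'X : {poly K}) = p.+1.
  by rewrite size_polyDl ?size_polyXn // size_polyN size_polyX ltnS prime_gt1.
have := @max_poly_roots _ ('X^p - 'X) (t :: s).
rewrite -size_poly_eq0 sz => /(_ isT) /=.
rewrite nts map_inj_uniq ?enum_uniq; last exact: natr_ord_inj.
rewrite size_map -cardE card_ord ltnn => H; suff: false by []; apply: H => //.
rewrite /root !hornerE tp subrr eqxx /=.
by apply/allP => _ /mapP[i _ ->]; rewrite /root !hornerE natFix subrr.
Qed.

(** The integers below p embed in [K] as its prime field, that is, as the fixed points of Frobenius.
    Those that are roots of f modulo p are thus the fixed elements of [rs]. *)
Lemma Np_count_Frobenius (K : fieldType) (p : nat) (f : {poly int})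
    (rs : seq K) :
    p \in [pchar K] -> uniq rs ->
    (forall t, root (map_poly intr f) t = (t \in rs)) ->
  Np p f = count (fun t => t ^+ p == t) rs.
Proof.
move=> pK urs rsE; rewrite /Np cardE -size_filter.
rewrite -(size_map (fun i : 'I_p => (i : nat)%:R : K)).
apply: perm_size; apply: uniq_perm.
- by rewrite map_inj_uniq ?enum_uniq //; apply: natr_ord_inj.
- exact: filter_uniq.
have rE (i : 'I_p) : (p %| f.[(i : nat)%:Z])%Z = ((i : nat)%:R \in rs).
  rewrite (dvdz_pcharf pK) -rsE /root.
  by rewrite -[(i : nat)%:R]/((i : nat)%:~R) horner_map.
move=> t; rewrite mem_filter (Frobenius_fixed_natr _ pK).
apply/mapP/andP => [[i]|[/mapP[i _ ->] irs]].
  by rewrite mem_enum inE rE => irs ->; split=> //; apply: map_f; rewrite mem_enum.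
by exists i => //; rewrite mem_enum inE rE.
Qed.

(** [K] is a splitting field of f over ['F_p]; the relations between x, y and z are Vieta's
    formulas, with no quadratic term in f. *)
Lemma splitting_depressed_cubic (p : nat) (a b : int) : prime p ->
  exists (K : fieldType) (x y z : K),
    [/\ p \in [pchar K], x + y + z = 0, x * y + y * z + z * x = a%:~R,
        x * y * z = - b%:~R
      & forall t, root (map_poly intr ('X^3 + a *: 'X + b%:P)) t
                  = (t \in [:: x; y; z])].
Proof.
move=> pp; set f := 'X^3 + _ + _.
have f0 : map_poly intr f != 0 :> {poly 'F_p}.
  rewrite -size_poly_eq0 (_ : size _ = 4%N) //.
  rewrite size_map_poly_id0 ?size_depressed_cubic //.
  by rewrite lead_coefE size_depressed_cubic !coefE /= mulr0 !addr0 oner_eq0.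
have [K [rs rsE _]] := FinSplittingFieldFor f0.
have pK : p \in [pchar K] by rewrite pchar_lalg pchar_Fp.
have fE : map_poly (in_alg K) (map_poly intr f) = 'X^3 + a%:~R *: 'X + b%:~R%:P.
  rewrite -map_poly_comp (eq_map_poly (g := intr)); last first.
    by move=> n; apply: (rmorph_int (in_alg K)).
  by rewrite !rmorphD /= map_polyXn map_polyZ map_polyX map_polyC.
have sz : size ('X^3 + a%:~R *: 'X + b%:~R%:P : {poly K}) = 4%N.
  rewrite -addrA size_polyDl ?size_polyXn // ltnS.
  rewrite (leq_trans (size_polyD _ _)) // geq_max.
  rewrite (leq_trans (size_scale_leq _ _)) ?size_polyX //=.
  by rewrite (leq_trans (size_polyC_leq1 _)).
rewrite fE eqp_monic ?monic_prod_XsubC // in rsE; last first.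
  by rewrite monicE lead_coefE sz !coefE /= mulr0 !addr0.
move/eqP: rsE => rsE.
have : size rs = 3%N by apply/succn_inj; rewrite -sz rsE size_prod_XsubC.
case: rs rsE => [|x [|y [|z []]]] // rsE _; exists K, x, y, z.
have rootE t : root (map_poly intr f) t = (t \in [:: x; y; z]).
  rewrite -root_prod_XsubC -rsE !rmorphD /= map_polyXn map_polyZ map_polyX.
  by rewrite map_polyC.
have {}rsE : 'X^3 + a%:~R *: 'X + b%:~R%:P
    = 'X^3 - (x + y + z) *: 'X^2 + (x * y + y * z + z * x) *: 'X
      - (x * y * z)%:P :> {poly K}.
  by rewrite rsE !big_cons big_nil -!mul_polyC !(rmorphD, rmorphM) /=; ring.
have coefs i := congr1 (fun q : {poly K} => q`_i) rsE.
have := coefs 2%N; have := coefs 1%N; have := coefs 0%N.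
rewrite !coefE /= !(mulr0, mulr1, oppr0, add0r, addr0) => -> -> c2.
by split=> //; [apply/eqP; rewrite -oppr_eq0 -c2 | rewrite opprK].
Qed.

Theorem theorem6 (a2 a3 : int) (u : nat -> int)
    (hu0 : u 0%N = 0) (hu1 : u 1%N = - a2) (hu2 : u 2%N = - a3)
    (hu : forall n : nat, u n.+3 + a2 * u n.+1 + a3 * u n = 0) :
  let f : {poly int} := 'X^3 + a2 *: 'X + a3%:P in
  let d : int := 9 * a3 ^+ 2 - 4 * a2 ^+ 3 in
  let D : int := disc f in
  forall p : nat, prime p ->
  ~~ (p %| 6 * D * a2 * a3 *
      ((20 * a2 ^+ 3 * a3 + 27 * a2 ^+ 3 + 9 * a2 * d) ^+ 2
       - d * (31 * a2 ^+ 2 + d) ^+ 2))%Z ->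
  [/\ (D * u p.-1 ^+ 2 = 0 %[mod p])%Z -> Np p f = 3%N,
      (D * u p.-1 ^+ 2 = a2 ^+ 4 %[mod p])%Z -> Np p f = 0%N
    & ~ (D * u p.-1 ^+ 2 = 0 %[mod p])%Z ->
      ~ (D * u p.-1 ^+ 2 = a2 ^+ 4 %[mod p])%Z -> Np p f = 1%N].
Proof.
move=> f d D p pp.
have [K [x [y [z [pK sum0 aE bE rE]]]]] := splitting_depressed_cubic a2 a3 pp.
(* Non-divisibility by p becomes nonvanishing in [K], which has characteristic p; hence D, a2 and a3
   are nonzero there. *)
rewrite (dvdz_pcharf pK) !rmorphM /= !mulf_eq0 !negb_or.
case/andP=> /andP[/andP[/andP[_ D0] a0] b0] _.
pose delta := (x - y) * (y - z) * (z - x).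
have DE : D%:~R = delta ^+ 2.
  rewrite /D disc_depressed_cubic /delta rmorphB (rmorphM _ (- 4)) (rmorphM _ 27) !rmorphXn /= -aE.
  rewrite -[a3%:~R]opprK -bE.
  have -> : z = - x - y.
    by move/eqP: sum0; rewrite addrC addr_eq0 opprD => /eqP.
  by ring.
have uxyz : uniq [:: x; y; z].
  rewrite DE sqrf_eq0 !mulf_eq0 !negb_or !subr_eq0 in D0.
  by case/andP: D0 => /andP[xy yz] zx; rewrite /= !inE negb_or xy yz eq_sym zx.
have modE (m n : int) : (m = n %[mod p])%Z <-> (m%:~R = n%:~R :> K).
  split=> [/eqP|/eqP H]; first rewrite eqz_mod_dvd (dvdz_pcharf pK) rmorphB.
    by rewrite subr_eq0 => /eqP.
  by apply/eqP; rewrite eqz_mod_dvd (dvdz_pcharf pK) rmorphB subr_eq0.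
pose F := pFrobenius_aut pK.
have FE t : F t = t ^+ p by rewrite /F pFrobenius_autE.
(* The coefficients of f come from integers, so Frobenius fixes them and sends roots to roots. *)
have stabF : {in [:: x; y; z], forall t, F t \in [:: x; y; z]}.
  move=> t; rewrite -!rE /root; set g := map_poly _ _ => /eqP gt0.
  have -> : g = map_poly F g.
    by rewrite /g -map_poly_comp; apply: eq_map_poly => n /=; rewrite rmorph_int.
  by rewrite horner_map /= gt0 rmorph0.
have := @root_permutation_trichotomy K x y z F uxyz sum0.
rewrite bE oppr_eq0 b0 aE a0 => /(_ isT isT (fmorph_inj F) stabF) /=.
(* D is the square of [delta], so the left side is the square of delta u_(p-1). The closed form at
   index p-1 has exponent p+2, which splits off [F] from a square, and squaring absorbs its sign. *)
have wE : (D * u p.-1 ^+ 2)%:~R = (x ^+ 2 * F x * (y - z)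
    + y ^+ 2 * F y * (z - x) + z ^+ 2 * F z * (x - y)) ^+ 2.
  rewrite rmorphM rmorphXn /= DE -exprMn.
  rewrite (@cubic_recurrence_closed_form K x y z (fun n => (u n)%:~R)) //.
  - have -> : p.-1.+3 = (2 + p)%N by rewrite add2n -[in RHS](prednK (prime_gt0 pp)).
    by rewrite sqrrN !FE -!exprD.
  - by rewrite hu0.
  - by rewrite hu1 aE rmorphN.
  - by rewrite hu2 bE rmorphN.
  move=> n; rewrite aE bE; have /(congr1 (fun m => m%:~R : K)) := hu n.
  by rewrite !rmorphD !rmorphM /= rmorph0 => /eqP; rewrite -addrA addr_eq0;
     move=> /eqP->; ring.
have NpE : Np p f = count (fun t => F t == t) [:: x; y; z].
  by rewrite (Np_count_Frobenius pK uxyz rE); apply: eq_count => t; rewrite FE.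
rewrite /= in NpE; rewrite -wE -NpE -rmorphXn /=.
(* This keeps the residues 0 and a2^4 distinct, so that the three cases exclude one another. *)
have a40 : ((a2 ^+ 4)%:~R : K) != 0 by rewrite rmorphXn /= expf_neq0.
case=> [[-> w0]|[-> w4]|[-> /eqP w0 /eqP w4]].
- split=> // /modE; first by rewrite w0 => /esym/eqP; rewrite (negbTE a40).
  by rewrite w0.
- split=> //.
  + by move=> /modE/eqP; rewrite w4 (negbTE a40).
  + by move=> _ H; case: H; apply/modE.
- by split=> // /modE.
Qed.
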